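(* Let $f,g:\mathbb{R}^n\to\mathbb{R}\cup\{+\infty\}$ be closed convex proper functions and let $h:\mathbb{R}^n\to\mathbb{R}$ be convex and $L$-smooth with $L>0$, such that there exist $x^\star,u^\star\in\mathbb{R}^n$ with $0\in\partial f(x^\star)+\nabla h(x^\star)+u^\star$ and $0\in\partial g^*(u^\star)-x^\star$. Let $\alpha=\frac1L$, let $x^0,u^0\in\mathbb{R}^n$, and let $\{(x^k,u^k)\}_{k\ge 0}$ be generated by $$u^{k+1}=\mathrm{prox}_{\alpha^{-1}g^*}\big(u^k+\tfrac1\alpha x^k\big),\qquad x^{k+1}=\mathrm{prox}_{\alpha f}\Big(x^k-\alpha(2u^{k+1}-u^k)-\alpha\nabla h\big(x^k+\alpha(u^k-u^{k+1})\big)\Big),\qquad k=0,1,2,\dots$$ For $k\ge1$ let $p^k=\alpha u^{k-1}+x^{k-1}-\alpha u^k\in\partial g^*(u^k)$, let $\widetilde\nabla f(x^k)=\frac1\alpha\big(x^{k-1}-\alpha(2u^k-u^{k-1})-\alpha\nabla h(p^k)-x^k\big)\in\partial f(x^k)$, and $v^k=\widetilde\nabla f(x^k)+u^k+\nabla h(p^k)$. Let $K\ge1$ be an integer, $\bar x^K=\frac1K\sum_{k=1}^K x^k$, $\bar u^K=\frac1K\sum_{k=1}^K u^k$. Then for all $x,u\in\mathbb{R}^n$ and all subgradients $\bar p^K\in\partial g^*(\bar u^K)$, $p\in\partial g^*(u)$, $\widetilde\nabla f(\bar x^K)\in\partial f(\bar x^K)$, $$\mathcal{L}(\bar x^K,u)-\mathcal{L}(x,\bar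 u^K)-\frac{1}{\alpha K}\left(\|x^0-x\|^2+\alpha^2\|u^0-u\|^2\right)=I_f+I_g+I_h-\mathcal{S}_h-\mathcal{S}_1-\mathcal{S}_2,$$ where $$I_f=\tfrac1K\sum_{k=1}^K\big(f(\bar x^K)-f(x^k)+\langle\widetilde\nabla f(\bar x^K),x^k-\bar x^K\rangle\big)+\tfrac1K\sum_{k=1}^K\big(f(x^k)-f(x)+\langle\widetilde\nabla f(x^k),x-x^k\rangle\big),$$ $$I_g=\tfrac1K\sum_{k=1}^K\big(g(p^k)-g(\bar p^K)+\langle u^k,\bar p^K-p^k\rangle\big)+\tfrac1K\sum_{k=1}^K\big(g(p)-g(p^k)+\langle u,p^k-p\rangle\big),$$ $$I_h=\tfrac1K\sum_{k=1}^K\Big(h(\bar x^K)-h(p^k)+\langle\nabla h(\bar x^K),p^k-\bar x^K\rangle+\tfrac\alpha2\|\nabla h(\bar x^K)-\nabla h(p^k)\|^2\Big)+\tfrac1K\sum_{k=1}^K\Big(h(p^k)-h(x)+\langle\nabla h(p^k),x-p^k\rangle+\tfrac\alpha2\|\nabla h(x)-\nabla h(p^k)\|^2\Big),$$ $$\mathcal{S}_h=\tfrac\alpha2\Big\|\nabla h(\bar x^K)+\tfrac1K\sum_{k=1}^K\big(\widetilde\nabla f(x^k)+u^k\big)\Big\|^2+\tfrac\alpha2\Big\|\nabla h(x)-\tfrac1K\sum_{k=1}^K\nabla h(p^k)\Big\|^2,$$ $$\mathcal{S}_1=\tfrac1{\alpha K}\Big(\Big\|x^0-x-\tfrac\alpha2\sum_{k=1}^K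 v^k\Big\|^2+\alpha^2\Big\|u^0-u-\tfrac12\sum_{k=1}^K v^k\Big\|^2\Big),$$ $$\mathcal{S}_2=\tfrac{\alpha}{2K^2}\sum_{k=1}^K\sum_{l=1}^{k-1}\Big(\|v^k-\nabla h(p^k)-(v^l-\nabla h(p^l))\|^2+\|\nabla h(p^k)-\nabla h(p^l)\|^2\Big).$$
   Context: $\langle\cdot,\cdot\rangle$ and $\|\cdot\|$ are the standard inner product and Euclidean norm on $\mathbb{R}^n$. $h$ is $L$-smooth if it is differentiable with $L$-Lipschitz gradient. $g^*(y)=\sup_x\{\langle y,x\rangle-g(x)\}$ is the Fenchel conjugate, $\partial$ the convex subdifferential, and $\mathrm{prox}_\varphi(x)=\arg\min_{y}\{\varphi(y)+\frac12\|y-x\|^2\}$. The Lagrangian is $\mathcal{L}(x,u)=f(x)+h(x)+\langle u,x\rangle-g^*(u)$, with $\mathcal{L}(x,u)=+\infty$ if $x\notin\mathrm{dom}\, f$ and $\mathcal{L}(x,u)=-\infty$ if $x\in\mathrm{dom}\, f$, $u\notin\mathrm{dom}\, g^*$; if $x\notin\mathrm{dom}\, f$ both sides of the equality are read as $-\infty$. The iteration is the Davis--Yin splitting algorithm (variant DYS-$gf$) for minimizing $f+g+h$. *)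

(* Defs.v *)
From HB Require Import structures.
From mathcomp Require Import all_boot all_order all_algebra.
From mathcomp Require Import all_classical all_reals all_analysis.

Set Implicit Arguments.
Unset Strict Implicit.
Unset Printing Implicit Defensive.

Import Order.TTheory GRing.Theory Num.Theory.
Import numFieldNormedType.Exports.

Local Open Scope classical_set_scope.
Local Open Scope ring_scope.

(* R^n is 'rV[R]_n. The library norm `|v| on matrices is the sup norm, so the
   Euclidean inner product and norm are introduced here; the topology and the
   notion of differentiability are the same for both norms. *)
Definition dot (R : realType) (n : nat) (u v : 'rV[R]_n) : R :=
  \sum_(i < n) u 0 i * v 0 i.

Definition enorm (R : realType) (n : nat) (u : 'rV[R]_n) : R :=
  Num.sqrt (dot u u).

Definition gradient (R : realType) (n : nat) (h : 'rV[R]_n -> R)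
    (x : 'rV[R]_n) : 'rV[R]_n :=
  \row_(i < n) 'D_(delta_mx 0 i) h x.

Definition Lsmooth (R : realType) (n : nat) (L : R) (h : 'rV[R]_n -> R) : Prop :=
  (forall x, differentiable h x) /\
  (forall x y, enorm (gradient h x - gradient h y) <= L * enorm (x - y)).

(* A function into R U {+oo} is a function into \bar R avoiding -oo; this
   requirement is part of proper_fun. *)
Definition proper_fun (R : realType) (n : nat) (phi : 'rV[R]_n -> \bar R) : Prop :=
  (forall x, phi x != -oo%E) /\ (exists x, phi x != +oo%E).

Definition econvex_fun (R : realType) (n : nat) (phi : 'rV[R]_n -> \bar R) : Prop :=
  forall (x y : 'rV[R]_n) (t : R), 0 < t -> t < 1 ->
    (phi (t *: x + (1 - t) *: y)%R <= t%:E * phi x + (1 - t)%:E * phi y)%E.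

Definition closed_fun (R : realType) (n : nat) (phi : 'rV[R]_n -> \bar R) : Prop :=
  closed [set z : 'rV[R]_n * R | (phi z.1 <= z.2%:E)%E].

Definition closed_convex_proper (R : realType) (n : nat)
    (phi : 'rV[R]_n -> \bar R) : Prop :=
  [/\ closed_fun phi, econvex_fun phi & proper_fun phi].

Definition conjugate (R : realType) (n : nat) (phi : 'rV[R]_n -> \bar R)
    (y : 'rV[R]_n) : \bar R :=
  ereal_sup [set ((dot y x)%:E - phi x)%E | x in [set: 'rV[R]_n]].

(* Empty at points where phi is not finite. *)
Definition subdifferential (R : realType) (n : nat) (phi : 'rV[R]_n -> \bar R)
    (x : 'rV[R]_n) : set 'rV[R]_n :=
  [set s | phi x \is a fin_num /\
           forall y, (phi x + (dot s (y - x)%R)%:E <= phi y)%E].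

(* xget picks an element of the set of minimizers (a singleton when phi is
   closed convex proper); 0 is a dummy value for an empty set. *)
Definition prox (R : realType) (n : nat) (phi : 'rV[R]_n -> \bar R)
    (x : 'rV[R]_n) : 'rV[R]_n :=
  xget 0 [set y | forall z,
    (phi y + (2^-1 * enorm (y - x)%R ^+ 2)%:E <=
     phi z + (2^-1 * enorm (z - x)%R ^+ 2)%:E)%E].

Definition lagrangian (R : realType) (n : nat) (f g : 'rV[R]_n -> \bar R)
    (h : 'rV[R]_n -> R) (x u : 'rV[R]_n) : \bar R :=
  if f x == +oo%E then +oo%E
  else if conjugate g u == +oo%E then -oo%E
  else (f x + (h x)%:E + (dot u x)%:E - conjugate g u)%E.

Definition average (R : realType) (n : nat) (K : nat)
    (w : nat -> 'rV[R]_n) : 'rV[R]_n :=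
  K%:R^-1 *: \sum_(1 <= k < K.+1) w k.

(* Main.v *)
Require Import Defs.
From HB Require Import structures.
From mathcomp Require Import all_boot all_order all_algebra.
From mathcomp Require Import all_classical all_reals all_analysis.
From mathcomp Require Import ring lra.

Set Implicit Arguments.
Unset Strict Implicit.
Unset Printing Implicit Defensive.

Import Order.TTheory GRing.Theory Num.Theory.
Import numFieldNormedType.Exports.

Local Open Scope classical_set_scope.
Local Open Scope ring_scope.

(** The proof has a convex-analytic part, which turns the proximal steps into
    subgradients and extended-real values into real ones, and an algebraic
    part, which is an exact identity between finite sums.

    Convex analysis.  A closed convex proper function with an affine minorant
    attains the minimum defining its prox, and the first-order condition at
    the minimizer says that the scaled residual is a subgradient
    ([prox_subgradient]).  Applied to [f] and to the conjugate of [g], both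
    minorized because the saddle point supplies a subgradient of each, this
    gives the two membership claims.  To remove [g] from the statement one needs
    the equality g(p) = <u,p> - g*(u) for p a subgradient of g* at u
    ([fenchel_young_eq]).  It is usually read off from the biconjugate theorem;
    here it follows from the prox alone.  The prox y of [g] at p + u has
    subgradient s = p + u - y, so y is a subgradient of g* at s, and monotonicity
    gives 0 <= <u - s, p - y> = - |p - y|^2; hence y = p and s = u.

    Algebra.  Put z_k = x_k + alpha u_k.  The iteration reads
    z_k = z_{k-1} - alpha v_k and p_k = x_k + alpha v_k, with
    v_k = s_k + u_k + G_k, where s_k and G_k are the (sub)gradients of [f] and
    [h].  The function values telescope inside I_f, I_g, I_h up to the bilinear
    sum of <s_k, x - x_k> + <u - u_k, p_k> + <G_k, x - p_k>.  Its only
    non-explicit ingredient is the sum of <v_k, z_k>, and that is a quadratic in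
    the v_k because z_k is z_0 minus alpha times a partial sum
    ([sum_dot_descent]).  The resulting square of the sum of the v_k, together
    with <z_0, sum of v_k>, is what S_1 contains once the squared initial
    distances are taken out.  In I_h - S_h - S_2 the averages of squares minus
    squares of averages are variances, that is normalized sums of pairwise
    distances ([sum_pairwise_dist]), and they cancel against S_2, leaving terms in
    <v_k, G_k> and |v_k|^2 that cancel the rest ([dys_gap_identity]).

    If f x = +oo, the summands f(x_k) - f(x) of I_f make the right side -oo, and
    the Lagrangian at (x, ubar), which is +oo, makes the left side -oo. *)

(** * The Euclidean inner product *)

Section Dot.
Variables (R : realType) (n : nat).
Implicit Types u v w : 'rV[R]_n.

Lemma dotC u v : dot u v = dot v u.
Proof. by apply: eq_bigr => i _; rewrite mulrC. Qed.

Lemma dotDl u v w : dot (u + v) w = dot u w + dot v w.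
Proof. by rewrite -big_split; apply: eq_bigr => i _; rewrite mxE mulrDl. Qed.

Lemma dotZl a u w : dot (a *: u) w = a * dot u w.
Proof. by rewrite mulr_sumr; apply: eq_bigr => i _; rewrite mxE mulrA. Qed.

Lemma dotNl u w : dot (- u) w = - dot u w.
Proof. by rewrite -scaleN1r dotZl mulN1r. Qed.

Lemma dotDr u v w : dot w (u + v) = dot w u + dot w v.
Proof. by rewrite dotC dotDl !(dotC _ w). Qed.

Lemma dotZr a u w : dot w (a *: u) = a * dot w u.
Proof. by rewrite dotC dotZl dotC. Qed.

Lemma dotNr u w : dot w (- u) = - dot w u.
Proof. by rewrite dotC dotNl dotC. Qed.

Lemma dot0l w : dot 0 w = 0.
Proof. by rewrite -(scale0r w) dotZl mul0r. Qed.

Lemma dot0r w : dot w 0 = 0.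
Proof. by rewrite dotC dot0l. Qed.

Definition dotE := (dotDl, dotDr, dotNl, dotNr, dotZl, dotZr).

Lemma dot_ge0 u : 0 <= dot u u.
Proof. by apply: sumr_ge0 => i _; rewrite -expr2 sqr_ge0. Qed.

Lemma dot_eq0 u : dot u u = 0 -> u = 0.
Proof.
move=> /eqP; rewrite psumr_eq0 => [/allP u0|i _]; last by rewrite -expr2 sqr_ge0.
apply/rowP => i; rewrite mxE; have := u0 i (mem_index_enum i).
by rewrite -expr2 sqrf_eq0 => /eqP.
Qed.

Lemma enorm2 u : enorm u ^+ 2 = dot u u.
Proof. by rewrite sqr_sqrtr // dot_ge0. Qed.

Lemma sqr_coord_le_dot u i : u 0 i ^+ 2 <= dot u u.
Proof.
rewrite /dot (bigD1 i) //= -expr2 lerDl.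
by apply: sumr_ge0 => j _; rewrite -expr2 sqr_ge0.
Qed.

Lemma dot_continuous (T : topologicalType) (F G : T -> 'rV[R]_n) :
  continuous F -> continuous G -> continuous (fun t => dot (F t) (G t)).
Proof.
move=> cF cG; rewrite /dot; elim: (index_enum _) => [|i r IHr] t.
  by under eq_fun do rewrite big_nil; exact: cvg_cst.
under eq_fun do rewrite big_cons.
apply: cvgD; last exact: IHr.
have coordP (H : T -> 'rV[R]_n) : continuous H -> H t' 0 i @[t' --> t] --> H t 0 i.
  move=> cH; exact: (continuous_comp (cH t) (@coord_continuous _ _ _ 0 i (H t))).
by apply: cvgM; exact: coordP.
Qed.

End Dot.

(** * Proximal points *)

Section Prox.
Variables (R : realType) (n : nat).
Implicit Types (phi : 'rV[R]_n -> \bar R) (x y z s : 'rV[R]_n).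

Definition affine_minorized phi :=
  exists (a : R) (s : 'rV[R]_n), forall y, ((a + dot s y)%:E <= phi y)%E.

Lemma subdifferential_minorized phi x s :
  subdifferential phi x s -> affine_minorized phi.
Proof.
move=> [fx le]; exists (fine (phi x) - dot s x), s => y.
have := le y; rewrite -{1}(fineK fx) -EFinD dotDr dotNr.
by apply: le_trans; rewrite lee_fin; lra.
Qed.

Lemma compact_box (m : 'rV[R]_n) (r : R) :
  compact [set y : 'rV[R]_n | forall i, `[m 0 i - r, m 0 i + r]%classic (y 0 i)].
Proof.
apply: (@rV_compact R n (fun i => `[m 0 i - r, m 0 i + r]%classic)) => i.
exact: segment_compact.
Qed.

(** The objective is only lower semicontinuous in y, so the continuous function
    c t + |y - x|^2 / 2 is minimized instead over points (y, t) of the closed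
    epigraph.  The affine minorant makes its sublevel sets bounded in both
    coordinates, hence compact. *)
Lemma prox_minimizer_exists phi (c : R) x :
  0 < c -> closed_fun phi -> proper_fun phi -> affine_minorized phi ->
  exists y, forall z,
    (c%:E * phi y + (2^-1 * enorm (y - x)%R ^+ 2)%:E <=
     c%:E * phi z + (2^-1 * enorm (z - x)%R ^+ 2)%:E)%E.
Proof.
move=> c0 cl [pN [x0 px0]] [a [s min]].
pose G (q : 'rV[R]_n * R) := c * q.2 + 2^-1 * dot (q.1 - x) (q.1 - x).
have cG : continuous G.
  move=> q; rewrite /G; apply: cvgD; apply: cvgM; try exact: cvg_cst.
    exact: cvg_snd.
  have cB : continuous (fun q : 'rV[R]_n * R => q.1 - x).
    by move=> p; apply: cvgB; [exact: cvg_fst|exact: cvg_cst].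
  exact: (dot_continuous cB cB).
have epi0 : (phi x0 <= (fine (phi x0))%:E)%E.
  by rewrite fineK // fin_numE pN px0.
set M := G (x0, fine (phi x0)).
(* Completing the square in c (a + <s,y>) + |y - x|^2 / 2 <= M puts y in the
   ball of centre m and squared radius B; since r = B + 1 has r^2 >= B, the box
   of half-width r around m contains it.  Then <s, y - m> >= -(B + |s|^2) / 2,
   which gives the lower bound lo on t. *)
pose m : 'rV[R]_n := x - c *: s.
pose B := 2 * (M - c * a - c * dot s x) + c ^+ 2 * dot s s.
pose r := B + 1.
pose lo := a + dot s x - c * dot s s - (B + dot s s) / 2.
pose E := [set q : 'rV[R]_n * R | (phi q.1 <= q.2%:E)%E].
pose A := E `&` [set q | G q <= M].
have clA : closed A.
  apply: closedI => //; apply: (@preimage_closed _ _ G [set t | t <= M]).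
    by move=> q _; exact: cG.
  exact: closed_le.
have cA : compact A.
  have cb := compact_setX (@compact_box m r) (@segment_compact R lo (M / c)).
  refine (subclosed_compact clA cb _).
  move=> [y t] [Et Gt].
  have ty : a + dot s y <= t by rewrite -lee_fin (le_trans (min y)).
  have qB : dot (y - m) (y - m) <= B.
    move: Gt; rewrite /G /= /B /m !dotE !(dotC _ s) !(dotC x y) => Gt.
    have : c * (a + dot s y) <= c * t by rewrite ler_pM2l.
    lra.
  have B0 : 0 <= B by exact: le_trans (dot_ge0 _) qB.
  split => /=.
    move=> i; have := le_trans (sqr_coord_le_dot (y - m) i) qB.
    rewrite !mxE in_itv /= /r => h.
    by apply/andP; split; nra.
  rewrite in_itv /=; apply/andP; split; last first.
    rewrite ler_pdivlMr // mulrC; move: Gt; rewrite /G /=.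
    have := dot_ge0 (y - x); lra.
  apply: le_trans ty; rewrite /lo.
  have := dot_ge0 (y - m + s).
move: qB; rewrite /m !dotE !(dotC _ s) !(dotC x y); lra.
have A0 : A !=set0 by exists (x0, fine (phi x0)); split => //=.
have wc : {within A, continuous G} by exact: continuous_subspaceT.
have [[y t] /set_mem [Ey Gy] ymin] := compact_EVT_min A0 cA wc.
exists y => z; rewrite !enorm2.
have [->|zoo] := eqVneq (phi z) +oo%E.
  by rewrite gt0_muley // addye // leey.
have [q Eq] : exists q, phi z = q%:E.
  by exists (fine (phi z)); rewrite fineK // fin_numE pN zoo.
rewrite Eq; apply: (@le_trans _ _ (G (y, t))%:E).
  rewrite EFinD; apply: leeD => //.
  by rewrite EFinM lee_pmul2l ?lte_fin.
rewrite -EFinM -EFinD lee_fin -/(G (z, q)).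
have [Gz|/ltW Gz] := leP (G (z, q)) M; last exact: le_trans Gz.
by apply: ymin; rewrite inE; split => //; rewrite /E /= Eq.
Qed.

(** Comparing y = prox with the points t z + (1 - t) y and dividing by t leaves
    the subgradient inequality up to an error of order t. *)
Lemma prox_subgradient phi (c : R) x :
  0 < c -> closed_convex_proper phi -> affine_minorized phi ->
  subdifferential phi (prox (fun y => c%:E * phi y)%E x)
    (c^-1 *: (x - prox (fun y => c%:E * phi y)%E x)).
Proof.
move=> c0 [cl cvx pr] aff; have [pN [x0 px0]] := pr.
have := xgetPex 0 (prox_minimizer_exists x c0 cl pr aff).
rewrite -/(prox (fun y => c%:E * phi y)%E x).
move: (prox _ x) => y ymin.
have phifin z : phi z != +oo%E -> phi z \is a fin_num.
  by move=> zoo; rewrite fin_numE pN zoo.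
have fy : phi y \is a fin_num.
  apply: (phifin y); apply/eqP => yoo; have := ymin x0.
  by rewrite yoo gt0_muley // addye // -(fineK (phifin _ px0)) -EFinM -EFinD leye_eq.
split=> // z; have [->|/phifin fz] := eqVneq (phi z) +oo%E; first by rewrite leey.
rewrite -(fineK fy) -(fineK fz) -EFinD lee_fin.
set b := fine (phi y); set q := fine (phi z).
have key t : 0 < t -> t < 1 ->
    c * (b - q) - dot (y - x) (z - y) <= t / 2 * dot (z - y) (z - y).
  move=> t0 t1; have := ymin (t *: z + (1 - t) *: y).
  have := cvx z y t t0 t1; rewrite -(fineK fy) -(fineK fz) -!EFinM -EFinD -/b -/q.
  move=> le1 le2.
  have /(le_trans le2) : (c%:E * phi (t *: z + (1 - t) *: y)%R +
     (2^-1 * enorm (t *: z + (1 - t) *: y - x)%R ^+ 2)%:E <=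
     (c * (t * q + (1 - t) * b))%:E +
     (2^-1 * enorm (t *: z + (1 - t) *: y - x)%R ^+ 2)%:E)%E.
    by apply: leeD => //; rewrite EFinM lee_pmul2l ?lte_fin.
  rewrite -!EFinD lee_fin !enorm2.
  have -> : t *: z + (1 - t) *: y - x = (y - x) + t *: (z - y).
    by rewrite scalerBl scalerBr scale1r; apply/rowP => i; rewrite !mxE; ring.
  move: (z - y) (y - x) => w e; rewrite !dotE (dotC w e) => le3.
  rewrite -(ler_pM2l t0); nra.
have : c * (b - q) - dot (y - x) (z - y) <= 0.
  set d := c * (b - q) - dot (y - x) (z - y) in key *; set D := dot (z - y) (z - y) in key.
  (* A positive violation d contradicts key at t = d / (D + d + 1), which lies in
     (0, 1) and has t * D / 2 < d. *)
  rewrite leNgt; apply/negP => d0; have D0 : 0 <= D := dot_ge0 _.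
  have s0 : 0 < D + d + 1 by lra.
  have := key (d / (D + d + 1)); rewrite divr_gt0 // ltr_pdivrMr // mul1r.
  move=> /(_ isT) /(_ ltac:(lra)).
  rewrite -mulrA mulrAC ler_pdivlMr //; nra.
move=> le0; rewrite dotZl -(ler_pM2l c0) mulrDr mulrA divff ?gt_eqF// mul1r.
by move: le0; rewrite -(opprB x y) dotNl; lra.
Qed.

End Prox.

(** * Conjugates and the Fenchel-Young equality *)

Section Conjugate.
Variables (R : realType) (n : nat).
Implicit Types (g : 'rV[R]_n -> \bar R) (x y z s u p : 'rV[R]_n).

Lemma le_conjugate g y x : ((dot y x)%:E - g x <= conjugate g y)%E.
Proof. by apply: ereal_sup_ubound; exists x. Qed.

Lemma conjugate_le g y (M : \bar R) :
  (forall x, (dot y x)%:E - g x <= M)%E -> (conjugate g y <= M)%E.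
Proof. by move=> h; apply: ge_ereal_sup => _ [x _ <-]. Qed.

Lemma conjugate_closed_convex_proper g : proper_fun g ->
  (exists u, conjugate g u \is a fin_num) ->
  closed_convex_proper (conjugate g).
Proof.
move=> [gN [x0 gx0]] [u0 fu0]; split.
- rewrite /closed_fun.
  (* The epigraph of a supremum of affine functions is an intersection of closed
     half-spaces. *)
  have -> : [set q : 'rV[R]_n * R | (conjugate g q.1 <= q.2%:E)%E] =
     \bigcap_(x in [set x | g x != +oo%E])
       [set q : 'rV[R]_n * R | dot q.1 x - q.2 <= fine (g x)].
    have gfin x : g x != +oo%E -> g x \is a fin_num.
      by move=> xoo; rewrite fin_numE gN.
    apply/seteqP; split => [[y t] /= le x /= /gfin xfin|[y t] /= le].
      have := le_trans (le_conjugate g y x) le.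
      by rewrite -{1}(fineK xfin) -EFinB lee_fin; lra.
    apply: conjugate_le => x; have [->|xoo] := eqVneq (g x) +oo%E.
      by rewrite addeNy leNye.
    have := le x xoo; rewrite -{2}(fineK (gfin _ xoo)) -EFinB lee_fin /=; lra.
  apply: closed_bigI => x _.
  apply: (@preimage_closed _ _ (fun q : 'rV[R]_n * R => dot q.1 x - q.2)
    [set t | t <= fine (g x)]); last exact: closed_le.
  move=> q _; apply: cvgB; last exact: cvg_snd.
  apply: (@dot_continuous R n _ fst (fun=> x)) => q'; first exact: cvg_fst.
  exact: cvg_cst.
- move=> y z t t0 t1; apply: conjugate_le => x.
  have [->|xoo] := eqVneq (g x) +oo%E; first by rewrite addeNy leNye.
  have fx : g x \is a fin_num by rewrite fin_numE gN.
  apply: (@le_trans _ _ (t%:E * ((dot y x)%:E - g x) +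
                         (1 - t)%:E * ((dot z x)%:E - g x))%E).
    rewrite -(fineK fx) -!EFinB -!EFinM -EFinD lee_fin !dotE; lra.
  by apply: leeD; apply: lee_wpmul2l; rewrite ?le_conjugate// lee_fin; lra.
- split; last by exists u0; apply: contraTneq fu0 => ->.
  move=> y; rewrite -ltNye; apply: lt_le_trans (le_conjugate g y x0).
  have fx : g x0 \is a fin_num by rewrite fin_numE gN.
  by rewrite -(fineK fx) -EFinB ltNyr.
Qed.

Lemma conjugate_subgradient g x s : subdifferential g x s ->
  conjugate g s = ((dot s x)%:E - g x)%E.
Proof.
move=> [fx le]; apply/le_anti/andP; split; last exact: le_conjugate.
apply: conjugate_le => z; have := le z; rewrite -(fineK fx) -EFinD.
case: (g z) => [r||] //=; last by rewrite ?leNye.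
  by rewrite -!EFinB !lee_fin !dotE; lra.
Qed.

Lemma subdifferential_conjugate g x s : subdifferential g x s ->
  subdifferential (conjugate g) s x.
Proof.
move=> sx; have [fx _] := sx; rewrite /subdifferential /= (conjugate_subgradient sx).
rewrite -(fineK fx) -EFinB; split => // z.
apply: le_trans (le_conjugate g z x); rewrite -{2}(fineK fx) -EFinD -EFinB lee_fin.
by rewrite (dotC x) !dotE; lra.
Qed.

Lemma subdifferential_monotone phi x y s u :
  subdifferential (n := n) (R := R) phi x s -> subdifferential phi y u ->
  0 <= dot (s - u) (x - y).
Proof.
move=> [fx lx] [fy ly]; have := ly x; have := lx y.
by rewrite -(fineK fx) -(fineK fy) -!EFinD !lee_fin !dotE; lra.
Qed.

(** The substitute for biconjugation: p + u has a prox decomposition y + s with s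
    a subgradient of g at y, and monotonicity of the subdifferential of the
    conjugate leaves y = p and s = u as the only possibility. *)
Lemma subdifferential_conjugateK g u p : closed_convex_proper g ->
  subdifferential (conjugate g) u p -> subdifferential g p u.
Proof.
move=> ccp up; have [_ _ [gN _]] := ccp; have [fu _] := up.
have aff : affine_minorized g.
  exists (- fine (conjugate g u)), u => y; have := le_conjugate g u y.
  rewrite -(fineK fu); case: (g y) (gN y) => [r _||] //; last by rewrite leey.
  by rewrite -EFinB !lee_fin; lra.
have := prox_subgradient (p + u) ltr01 ccp aff.
rewrite invr1 scale1r; move: (prox _ _) => y sy.
have := subdifferential_monotone up (subdifferential_conjugate sy).
have -> : u - (p + u - y) = - (p - y).
  by apply/rowP => i; rewrite !mxE; ring.
rewrite dotNr oppr_ge0 => le0.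
have /dot_eq0/eqP : dot (p - y) (p - y) = 0.
  by apply/le_anti; rewrite le0 dot_ge0.
by rewrite subr_eq0 => /eqP py; move: sy; rewrite -py addrC addKr.
Qed.

Lemma fenchel_young_eq g u p : closed_convex_proper g ->
  subdifferential (conjugate g) u p ->
  g p = (dot u p - fine (conjugate g u))%:E.
Proof.
move=> ccp up; have sp := subdifferential_conjugateK ccp up; have [fp _] := sp.
rewrite (conjugate_subgradient sp) -(fineK fp) -EFinB /=; congr EFin; lra.
Qed.

End Conjugate.

(** * The finite-sum identity *)

Section Identity.
Variables (R : realType) (n : nat).

Lemma sum_dist_to (a : 'rV[R]_n) (w : nat -> 'rV[R]_n) (m : nat) :
  \sum_(1 <= l < m.+1) dot (a - w l) (a - w l) =
  m%:R * dot a a - 2 * dot (\sum_(1 <= l < m.+1) w l) a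
  + \sum_(1 <= l < m.+1) dot (w l) (w l).
Proof.
elim: m => [|m IH]; first by rewrite !big_geq// dot0l; ring.
rewrite big_nat_recr //= IH !(big_nat_recr m.+1) //= -natr1.
by rewrite !dotE (dotC a (w _)); ring.
Qed.

(** K^2 times the variance of w_1, ..., w_K. *)
Lemma sum_pairwise_dist (w : nat -> 'rV[R]_n) (K : nat) :
  \sum_(1 <= k < K.+1) \sum_(1 <= l < k) dot (w k - w l) (w k - w l) =
  K%:R * \sum_(1 <= k < K.+1) dot (w k) (w k)
  - dot (\sum_(1 <= k < K.+1) w k) (\sum_(1 <= k < K.+1) w k).
Proof.
elim: K => [|K IH]; first by rewrite !big_geq// dot0l mul0r subrr.
rewrite big_nat_recr //= IH sum_dist_to !(big_nat_recr K.+1) //= -natr1.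
by rewrite !dotE (dotC (w _) (\sum_(_ <= _ < _) _)); ring.
Qed.

(** Expanding z_k = z_0 - alpha (v_1 + ... + v_k) leaves the sum of <v_k, v_l>
    over l <= k, half of the full double sum plus half of its diagonal. *)
Lemma sum_dot_descent (alpha : R) (v z : nat -> 'rV[R]_n) (K : nat) :
  (forall k, z k.+1 = z k - alpha *: v k.+1) ->
  let V := \sum_(1 <= k < K.+1) v k in
  \sum_(1 <= k < K.+1) dot (v k) (z k) =
  dot V (z 0%N) - alpha / 2 * (dot V V + \sum_(1 <= k < K.+1) dot (v k) (v k)).
Proof.
move=> hz /=.
have zE k : z k = z 0%N - alpha *: \sum_(1 <= l < k.+1) v l.
  elim: k => [|k IH]; first by rewrite big_geq // scaler0 subr0.
  by rewrite hz IH [in RHS]big_nat_recr //= scalerDr opprD addrA.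
elim: K => [|K IH]; first by rewrite !big_geq// !dot0l addr0 mulr0 subr0.
rewrite big_nat_recr //= IH (zE K.+1) !(big_nat_recr K.+1) //=.
move: (\sum_(_ <= _ < _) v _) (\sum_(_ <= _ < _) dot _ _) => V s.
by rewrite !dotE (dotC (v _) V); field.
Qed.

(** All gradient information enters the gap through this sum.  Substituting S and
    P turns its k-th term into <u,X_k> - <U_k,x> - alpha <V_k,G_k> plus
    <V_k, x + alpha u - Z_k> with Z_k = X_k + alpha U_k, and Z performs the
    descent Z_{k+1} = Z_k - alpha V_{k+1}, so [sum_dot_descent] applies. *)
Lemma sum_subgradient_gap (alpha : R) (X U S G V P : nat -> 'rV[R]_n)
  (x u : 'rV[R]_n) (K : nat) :
  (forall k, S k = V k - U k - G k) ->
  (forall k, P k = X k + alpha *: V k) ->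
  (forall k, X k.+1 = X k - alpha *: (V k.+1 + U k.+1 - U k)) ->
  let sV := \sum_(1 <= k < K.+1) V k in
  \sum_(1 <= k < K.+1) dot (S k) (x - X k)
  + \sum_(1 <= k < K.+1) dot (u - U k) (P k)
  + \sum_(1 <= k < K.+1) dot (G k) (x - P k) =
  dot u (\sum_(1 <= k < K.+1) X k) - dot (\sum_(1 <= k < K.+1) U k) x
  - alpha * \sum_(1 <= k < K.+1) dot (V k) (G k)
  + alpha / 2 * \sum_(1 <= k < K.+1) dot (V k) (V k)
  + alpha / 2 * dot sV sV
  + dot sV (x + alpha *: u - (X 0%N + alpha *: U 0%N)).
Proof.
move=> hS hP hX sV.
have hZ k : X k.+1 + alpha *: U k.+1 = X k + alpha *: U k - alpha *: V k.+1.
  by rewrite hX; apply/rowP => i; rewrite !mxE; ring.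
have := sum_dot_descent (z := fun k => X k + alpha *: U k) K hZ.
rewrite /= -/sV => desc.
have : \sum_(1 <= k < K.+1) dot (S k) (x - X k)
  + \sum_(1 <= k < K.+1) dot (u - U k) (P k)
  + \sum_(1 <= k < K.+1) dot (G k) (x - P k) =
  dot u (\sum_(1 <= k < K.+1) X k) - dot (\sum_(1 <= k < K.+1) U k) x
  - alpha * \sum_(1 <= k < K.+1) dot (V k) (G k)
  + dot sV (x + alpha *: u)
  - \sum_(1 <= k < K.+1) dot (V k) (X k + alpha *: U k).
  rewrite /sV {desc sV}; elim: K => [|K IH].
    by rewrite !big_geq// !dot0l dot0r; ring.
  rewrite !(big_nat_recr K.+1) //= !(dotDl _ (_ K.+1)) !(dotDr _ (_ K.+1)).
  rewrite !addrA in IH *.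
  pose t := dot (S K.+1) (x - X K.+1) + dot (u - U K.+1) (P K.+1)
    + dot (G K.+1) (x - P K.+1).
  have tE : t = dot u (X K.+1) - dot (U K.+1) x
     - alpha * dot (V K.+1) (G K.+1) + dot (V K.+1) (x + alpha *: u)
     - dot (V K.+1) (X K.+1 + alpha *: U K.+1).
    rewrite /t hS hP; move: (X _) (U _) (V _) (G _) => a b c d.
    rewrite !dotE (dotC c a) (dotC d a) (dotC d c) (dotC c b) (dotC c u).
    by ring.
  move: IH tE; rewrite /t; lra.
by move=> ->; rewrite desc (dotDr (x + _)) dotNr; field.
Qed.

(** The next lemmas expand the sums in I_f, I_g and I_h so that the function
    values at the iterates, ff, gg and hh, appear only as sums that cancel
    between the two halves of each. *)
Section Telescoped.
Variables (alpha : R) (K : nat).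
Variables (fxb fx hxb hx gsu gsub gp gpb : R) (ff gg hh : nat -> R).
Variables (X U S G V P : nat -> 'rV[R]_n) (x u pb p sfb c d : 'rV[R]_n).

Lemma sum_linearization_fixed b :
  \sum_(1 <= k < K.+1) (fxb - ff k + dot sfb (X k - b)) =
  K%:R * (fxb - dot sfb b) - \sum_(1 <= k < K.+1) ff k
  + dot sfb (\sum_(1 <= k < K.+1) X k).
Proof.
elim: K => [|m IH]; first by rewrite !big_geq// dot0r; ring.
by rewrite !(big_nat_recr m.+1) //= IH -natr1 !dotE; ring.
Qed.

Lemma sum_linearization_moving :
  \sum_(1 <= k < K.+1) (ff k - fx + dot (S k) (x - X k)) =
  \sum_(1 <= k < K.+1) ff k - K%:R * fx
  + \sum_(1 <= k < K.+1) dot (S k) (x - X k).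
Proof.
elim: K => [|m IH]; first by rewrite !big_geq//; ring.
by rewrite !(big_nat_recr m.+1) //= IH -natr1; ring.
Qed.

Lemma sum_conjugate_linearizations :
  \sum_(1 <= k < K.+1) (gg k - gpb + dot (U k) (pb - P k))
  + \sum_(1 <= k < K.+1) (gp - gg k + dot u (P k - p)) =
  K%:R * (gp - dot u p) - K%:R * gpb + dot (\sum_(1 <= k < K.+1) U k) pb
  + \sum_(1 <= k < K.+1) dot (u - U k) (P k).
Proof.
elim: K => [|m IH]; first by rewrite !big_geq// dot0l; ring.
rewrite !(big_nat_recr m.+1) //= -natr1 (dotDl _ (U _)).
have -> : dot (U m.+1) (pb - P m.+1) = dot (U m.+1) pb - dot (U m.+1) (P m.+1).
  by rewrite !dotE.
have -> : dot u (P m.+1 - p) = dot u (P m.+1) - dot u p by rewrite !dotE.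
have -> : dot (u - U m.+1) (P m.+1) = dot u (P m.+1) - dot (U m.+1) (P m.+1).
  by rewrite !dotE.
move: IH; lra.
Qed.

Lemma sum_smooth_linearization_fixed b : (forall k, P k = X k + alpha *: V k) ->
  \sum_(1 <= k < K.+1) (hxb - hh k + dot c (P k - b)
    + alpha / 2 * enorm (c - G k) ^+ 2) =
  K%:R * (hxb - dot c b + alpha / 2 * dot c c) - \sum_(1 <= k < K.+1) hh k
  + dot c (\sum_(1 <= k < K.+1) X k) + alpha * dot c (\sum_(1 <= k < K.+1) V k)
  - alpha * dot c (\sum_(1 <= k < K.+1) G k)
  + alpha / 2 * \sum_(1 <= k < K.+1) dot (G k) (G k).
Proof.
move=> hP; elim: K => [|m IH]; first by rewrite !big_geq// !dot0r; ring.
rewrite !(big_nat_recr m.+1) //= IH -natr1 hP enorm2.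
by rewrite !dotE (dotC (G _) c); field.
Qed.

Lemma sum_smooth_linearization_moving :
  \sum_(1 <= k < K.+1) (hh k - hx + dot (G k) (x - P k)
    + alpha / 2 * enorm (d - G k) ^+ 2) =
  K%:R * (alpha / 2 * dot d d - hx) + \sum_(1 <= k < K.+1) hh k
  + \sum_(1 <= k < K.+1) dot (G k) (x - P k)
  - alpha * dot d (\sum_(1 <= k < K.+1) G k)
  + alpha / 2 * \sum_(1 <= k < K.+1) dot (G k) (G k).
Proof.
elim: K => [|m IH]; first by rewrite !big_geq// !dot0r; ring.
rewrite !(big_nat_recr m.+1) //= IH -natr1 enorm2.
by rewrite !dotE (dotC (G _) d); field.
Qed.

Lemma sum_dot_subr :
  \sum_(1 <= k < K.+1) dot (V k - G k) (V k - G k) =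
  \sum_(1 <= k < K.+1) dot (V k) (V k)
  - 2 * \sum_(1 <= k < K.+1) dot (V k) (G k)
  + \sum_(1 <= k < K.+1) dot (G k) (G k).
Proof.
elim: K => [|m IH]; first by rewrite !big_geq//; ring.
by rewrite !(big_nat_recr m.+1) //= IH !dotE (dotC (G _) (V _)); ring.
Qed.

(** The hypotheses on gpb and gp are the Fenchel-Young equalities at the averaged
    and at the arbitrary dual point. *)
Lemma dys_gap_identity :
  (0 < K)%N -> alpha != 0 ->
  (forall k, V k = S k + U k + G k) ->
  (forall k, P k = X k + alpha *: V k) ->
  (forall k, X k.+1 = X k - alpha *: (V k.+1 + U k.+1 - U k)) ->
  gpb = dot (average K U) pb - gsub -> gp = dot u p - gsu ->
  (fxb + hxb + dot u (average K X) - gsu) - (fx + hx + dot (average K U) x - gsub)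
  - 1 / (alpha * K%:R) *
      (enorm (X 0%N - x) ^+ 2 + alpha ^+ 2 * enorm (U 0%N - u) ^+ 2) =
  (K%:R^-1 * \sum_(1 <= k < K.+1) (fxb - ff k + dot sfb (X k - average K X))
   + K%:R^-1 * \sum_(1 <= k < K.+1) (ff k - fx + dot (S k) (x - X k)))
  + (K%:R^-1 * \sum_(1 <= k < K.+1) (gg k - gpb + dot (U k) (pb - P k))
     + K%:R^-1 * \sum_(1 <= k < K.+1) (gp - gg k + dot u (P k - p)))
  + (K%:R^-1 * \sum_(1 <= k < K.+1)
       (hxb - hh k + dot c (P k - average K X)
        + alpha / 2 * enorm (c - G k) ^+ 2)
     + K%:R^-1 * \sum_(1 <= k < K.+1)
       (hh k - hx + dot (G k) (x - P k) + alpha / 2 * enorm (d - G k) ^+ 2))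
  - (alpha / 2 * enorm (c + K%:R^-1 *: \sum_(1 <= k < K.+1) (S k + U k)) ^+ 2
     + alpha / 2 * enorm (d - K%:R^-1 *: \sum_(1 <= k < K.+1) G k) ^+ 2)
  - 1 / (alpha * K%:R) *
      (enorm (X 0%N - x - (alpha / 2) *: \sum_(1 <= k < K.+1) V k) ^+ 2
       + alpha ^+ 2 *
         enorm (U 0%N - u - (1 / 2) *: \sum_(1 <= k < K.+1) V k) ^+ 2)
  - alpha / (2 * K%:R ^+ 2) * \sum_(1 <= k < K.+1) \sum_(1 <= l < k)
      (enorm (V k - G k - (V l - G l)) ^+ 2 + enorm (G k - G l) ^+ 2).
Proof.
move=> K0 a0 hV hP hX egpb egp.
have Kn0 : K%:R != 0 :> R by rewrite pnatr_eq0 -lt0n.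
have hS k : S k = V k - U k - G k.
  by rewrite hV; apply/rowP => i; rewrite !mxE; ring.
have gap := sum_subgradient_gap x u K hS hP hX.
have eSU : \sum_(1 <= k < K.+1) (S k + U k) =
    \sum_(1 <= k < K.+1) V k - \sum_(1 <= k < K.+1) G k.
  by rewrite -sumrB; apply: eq_bigr => k _; rewrite hV addrK.
have eVG : \sum_(1 <= k < K.+1) (V k - G k) =
    \sum_(1 <= k < K.+1) V k - \sum_(1 <= k < K.+1) G k by rewrite sumrB.
have eS2 : \sum_(1 <= k < K.+1) \sum_(1 <= l < k)
      (enorm (V k - G k - (V l - G l)) ^+ 2 + enorm (G k - G l) ^+ 2) =
    \sum_(1 <= k < K.+1) \sum_(1 <= l < k)
      dot (V k - G k - (V l - G l)) (V k - G k - (V l - G l)) +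
    \sum_(1 <= k < K.+1) \sum_(1 <= l < k) dot (G k - G l) (G k - G l).
  rewrite -big_split /=; apply: eq_bigr => k _.
  by rewrite -big_split /=; apply: eq_bigr => l _; rewrite !enorm2.
rewrite eS2 (sum_pairwise_dist (fun k => V k - G k)) sum_pairwise_dist.
rewrite sum_dot_subr eVG eSU.
(* The two halves of I_g are summed together because their separate bilinear
   parts only combine into the sum of <u - U_k, P_k>. *)
rewrite -[K%:R^-1 * _ + K%:R^-1 * \sum_(_ <= k < _) (gp - _ + _)]mulrDr.
rewrite sum_conjugate_linearizations sum_linearization_fixed sum_linearization_moving sum_smooth_linearization_fixed // sum_smooth_linearization_moving !enorm2.
rewrite egpb egp /average.
move: gap => /=.
move: (\sum_(_ <= _ < _) X _) (\sum_(_ <= _ < _) U _) (\sum_(_ <= _ < _) V _)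
  (\sum_(_ <= _ < _) G _) => sX sU sV sG.
move: (\sum_(_ <= _ < _) dot (S _) _) (\sum_(_ <= _ < _) dot (u - _) _)
  (\sum_(_ <= _ < _) dot (G _) (x - _)) (\sum_(_ <= _ < _) dot (V _) (V _))
  (\sum_(_ <= _ < _) dot (V _) (G _)) (\sum_(_ <= _ < _) dot (G _) (G _))
  (\sum_(_ <= _ < _) ff _) (\sum_(_ <= _ < _) hh _)
   => t1 t2 t3 sVV sVG sGG sf sh.
move: (X 0%N) (U 0%N) => X0 U0 gap.
have {gap} -> : t1 = dot u sX - dot sU x - alpha * sVG + alpha / 2 * sVV
  + alpha / 2 * dot sV sV + dot sV (x + alpha *: u - (X0 + alpha *: U0)) - t2 - t3.
  by rewrite -gap; ring.
rewrite !dotE.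
rewrite !(dotC _ sV) !(dotC _ sG) !(dotC _ c) !(dotC _ d) !(dotC _ x) !(dotC _ u).
by field; rewrite Kn0 a0.
Qed.

End Telescoped.
End Identity.

(** * Averages of extended reals *)

Section ErealSums.
Variables (R : realType) (n K : nat).

Lemma mean_EFin (F : nat -> \bar R) (G : nat -> R) :
  (forall k, (1 <= k)%N -> F k = (G k)%:E) ->
  ((K%:R^-1)%:E * \sum_(1 <= k < K.+1) F k =
   (K%:R^-1 * \sum_(1 <= k < K.+1) G k)%:E)%E.
Proof.
move=> FG; rewrite EFinM -sumEFin; congr (_ * _)%E.
by apply: eq_big_nat => k /andP[k1 _]; exact: FG.
Qed.

Lemma mean_Ny (F : nat -> \bar R) : (0 < K)%N ->
  (forall k, (1 <= k)%N -> F k = -oo%E) ->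
  ((K%:R^-1)%:E * \sum_(1 <= k < K.+1) F k = -oo)%E.
Proof.
move=> K0 FN; rewrite big_ltn ?ltnS// FN // addNye gt0_muleNy //.
by rewrite lte_fin invr_gt0 ltr0n.
Qed.

End ErealSums.

(** * The gap of the averaged iterates *)

Theorem proposition4p1 (R : realType) (n : nat)
  (f g : 'rV[R]_n -> \bar R) (h : 'rV[R]_n -> R) (L : R)
  (hf : closed_convex_proper f) (hg : closed_convex_proper g)
  (hh : convex_function setT h) (hL : 0 < L) (hsm : Lsmooth L h)
  (hsol : exists xs us : 'rV[R]_n,
     [set s + gradient h xs + us | s in subdifferential f xs] 0 /\
     [set s - xs | s in subdifferential (conjugate g) us] 0)
  (alpha : R) (halpha : alpha = 1 / L)
  (x_ u_ : nat -> 'rV[R]_n)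
  (hu : forall k : nat, u_ k.+1 =
     prox (fun y => (alpha^-1)%:E * conjugate g y)%E
          (u_ k + (1 / alpha) *: x_ k))
  (hx : forall k : nat, x_ k.+1 =
     prox (fun y => alpha%:E * f y)%E
          (x_ k - alpha *: (2 *: u_ k.+1 - u_ k)
           - alpha *: gradient h (x_ k + alpha *: (u_ k - u_ k.+1)))) :
  let p_ (k : nat) := alpha *: u_ k.-1 + x_ k.-1 - alpha *: u_ k in
  let sf (k : nat) := (1 / alpha) *:
        (x_ k.-1 - alpha *: (2 *: u_ k - u_ k.-1)
         - alpha *: gradient h (p_ k) - x_ k) in
  let v_ (k : nat) := sf k + u_ k + gradient h (p_ k) in
  (forall k : nat, (1 <= k)%N ->
     subdifferential (conjugate g) (u_ k) (p_ k) /\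
     subdifferential f (x_ k) (sf k))
  /\
  (forall K : nat, (1 <= K)%N ->
   let xbar := average K x_ in
   let ubar := average K u_ in
   forall (x u pbar p sfbar : 'rV[R]_n),
   subdifferential (conjugate g) ubar pbar ->
   subdifferential (conjugate g) u p ->
   subdifferential f xbar sfbar ->
   let I_f : \bar R :=
     ((K%:R^-1)%:E * \sum_(1 <= k < K.+1)
        (f xbar - f (x_ k) + (dot sfbar (x_ k - xbar)%R)%:E)
      + (K%:R^-1)%:E * \sum_(1 <= k < K.+1)
        (f (x_ k) - f x + (dot (sf k) (x - x_ k)%R)%:E))%E in
   let I_g : \bar R :=
     ((K%:R^-1)%:E * \sum_(1 <= k < K.+1)
        (g (p_ k) - g pbar + (dot (u_ k) (pbar - p_ k)%R)%:E)
      + (K%:R^-1)%:E * \sum_(1 <= k < K.+1)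
        (g p - g (p_ k) + (dot u (p_ k - p)%R)%:E))%E in
   let I_h : R :=
     K%:R^-1 * \sum_(1 <= k < K.+1)
        (h xbar - h (p_ k) + dot (gradient h xbar) (p_ k - xbar)
         + alpha / 2 * enorm (gradient h xbar - gradient h (p_ k)) ^+ 2)
     + K%:R^-1 * \sum_(1 <= k < K.+1)
        (h (p_ k) - h x + dot (gradient h (p_ k)) (x - p_ k)
         + alpha / 2 * enorm (gradient h x - gradient h (p_ k)) ^+ 2) in
   let S_h : R :=
     alpha / 2 * enorm (gradient h xbar
        + K%:R^-1 *: \sum_(1 <= k < K.+1) (sf k + u_ k)) ^+ 2
     + alpha / 2 * enorm (gradient h x
        - K%:R^-1 *: \sum_(1 <= k < K.+1) gradient h (p_ k)) ^+ 2 in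
   let S_1 : R :=
     1 / (alpha * K%:R) *
       (enorm (x_ 0%N - x - (alpha / 2) *: \sum_(1 <= k < K.+1) v_ k) ^+ 2
        + alpha ^+ 2 *
          enorm (u_ 0%N - u - (1 / 2) *: \sum_(1 <= k < K.+1) v_ k) ^+ 2) in
   let S_2 : R :=
     alpha / (2 * K%:R ^+ 2) * \sum_(1 <= k < K.+1) \sum_(1 <= l < k)
       (enorm (v_ k - gradient h (p_ k) - (v_ l - gradient h (p_ l))) ^+ 2
        + enorm (gradient h (p_ k) - gradient h (p_ l)) ^+ 2) in
   (lagrangian f g h xbar u - lagrangian f g h x ubar
    - (1 / (alpha * K%:R) *
         (enorm (x_ 0%N - x)%R ^+ 2 + alpha ^+ 2 * enorm (u_ 0%N - u)%R ^+ 2))%:E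
    = I_f + I_g + I_h%:E - S_h%:E - S_1%:E - S_2%:E)%E).
Proof.
have a0 : 0 < alpha by rewrite halpha divr_gt0.
move=> p_ sf v_.
have [xs [us [[sfs sfsP _] [sgs sgsP _]]]] := hsol.
have ccpg : closed_convex_proper (conjugate g).
  have [_ _ prg] := hg; apply: conjugate_closed_convex_proper => //.
  by exists us; have [] := sgsP.
have subg k : (1 <= k)%N -> subdifferential (conjugate g) (u_ k) (p_ k).
  case: k => // k _; rewrite /p_ /= hu.
  set w := u_ k + _; have alphaV0 : 0 < alpha^-1 by rewrite invr_gt0.
  have := prox_subgradient w alphaV0 ccpg (subdifferential_minorized sgsP).
  rewrite invrK scalerBr; congr subdifferential; congr (_ - _).
  by rewrite scalerDr scalerA div1r divff ?gt_eqF // scale1r.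
have subf k : (1 <= k)%N -> subdifferential f (x_ k) (sf k).
  case: k => // k _; rewrite /sf /=.
  have -> : p_ k.+1 = x_ k + alpha *: (u_ k - u_ k.+1).
    by rewrite /p_ /= scalerBr addrCA addrA.
  rewrite hx div1r.
  exact: prox_subgradient a0 hf (subdifferential_minorized sfsP).
split; first by move=> k k1; split; [exact: subg|exact: subf].
move=> K K0 xbar ubar x u pbar p sfbar hpbar hp hsfbar.
move=> I_f I_g I_h S_h S_1 S_2.
have fxb : f xbar = (fine (f xbar))%:E by rewrite fineK //; case: hsfbar.
have fk k : (1 <= k)%N -> f (x_ k) = (fine (f (x_ k)))%:E.
  by move=> /subf [fin _]; rewrite fineK.
have gk k : (1 <= k)%N -> g (p_ k) = (fine (g (p_ k)))%:E.
  by move=> /subg /(fenchel_young_eq hg) ->.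
have gsu : conjugate g u = (fine (conjugate g u))%:E.
  by rewrite fineK //; case: hp.
have gsub : conjugate g ubar = (fine (conjugate g ubar))%:E.
  by rewrite fineK //; case: hpbar.
have gp := fenchel_young_eq hg hp.
have gpb := fenchel_young_eq hg hpbar.
have Ig : I_g = (K%:R^-1 * \sum_(1 <= k < K.+1)
      (fine (g (p_ k)) - fine (g pbar) + dot (u_ k) (pbar - p_ k))
    + K%:R^-1 * \sum_(1 <= k < K.+1)
      (fine (g p) - fine (g (p_ k)) + dot u (p_ k - p)))%:E.
  rewrite EFinD; congr (_ + _)%E; apply: mean_EFin => k k1.
    by rewrite (gk _ k1) gpb -EFinB -EFinD.
  by rewrite (gk _ k1) gp -EFinB -EFinD.
have If1 : ((K%:R^-1)%:E * \sum_(1 <= k < K.+1)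
        (f xbar - f (x_ k) + (dot sfbar (x_ k - xbar)%R)%:E) =
    (K%:R^-1 * \sum_(1 <= k < K.+1)
      (fine (f xbar) - fine (f (x_ k)) + dot sfbar (x_ k - xbar)))%:E)%E.
  by apply: mean_EFin => k k1; rewrite fxb (fk _ k1) -EFinB -EFinD.
rewrite /lagrangian {1 2}fxb gsu gsub /=.
have [fx|fxoo] := eqVneq (f x) +oo%E.
  rewrite Ig /I_f If1 mean_Ny // => k k1.
  by rewrite fx (fk _ k1).
have fx : f x = (fine (f x))%:E.
  by have [_ _ [fN _]] := hf; rewrite fineK // fin_numE fN fxoo.
have If : I_f = (K%:R^-1 * \sum_(1 <= k < K.+1)
      (fine (f xbar) - fine (f (x_ k)) + dot sfbar (x_ k - xbar))
    + K%:R^-1 * \sum_(1 <= k < K.+1)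
      (fine (f (x_ k)) - fine (f x) + dot (sf k) (x - x_ k)))%:E.
  rewrite /I_f If1 EFinD; congr (_ + _)%E; apply: mean_EFin => k k1.
  by rewrite (fk _ k1) fx -EFinB -EFinD.
rewrite If Ig fx /= !(=^~ EFinD, =^~ EFinN); congr EFin.
rewrite /I_h /S_h /S_1 /S_2.
apply: (dys_gap_identity (fine (f xbar)) (fine (f x)) (h xbar) (h x)
  (fun k => fine (f (x_ k))) (fun k => fine (g (p_ k))) (fun k => h (p_ k))
  (S := sf) (G := fun k => gradient h (p_ k)) (V := v_) (P := p_)) => //.
- by rewrite gt_eqF.
(* At k = 0 the predecessor convention 0.-1 = 0 gives p_0 = x_0 and v_0 = 0, so
   this relation holds there as well. *)
- move=> k; rewrite /v_ /sf; apply/rowP => i; rewrite /p_ !mxE.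
  by field; rewrite gt_eqF.
- move=> k; rewrite /v_ /sf /=; apply/rowP => i; rewrite !mxE.
  by field; rewrite gt_eqF.
- by rewrite gpb.
- by rewrite gp.
Qed.
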